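(* Let $\psi,\nu\in\Psi$, let $F,G\subset\mathcal B$ be sub-sigma-algebras with $\alpha:=\alpha(F,G)>0$, and let $\xi\in G\psi$ be an $F$-measurable random variable and $\eta\in G\nu$ a $G$-measurable random variable. Then $$|\mathrm{Cov}(\xi,\eta)|\le \frac{12\,\alpha\,\|\xi\|_{G\psi}\,\|\eta\|_{G\nu}}{\Phi[\psi,\nu](\alpha,\alpha)}=\frac{12\,\alpha\,\|\xi\|_{G\psi}\,\|\eta\|_{G\nu}}{\phi[G\theta_{\alpha}](\alpha)} .$$
   Context: $(\Omega,\mathcal B,\mathbf P)$ is a probability space with expectation $\mathbf E$; $\mathrm{Cov}(\xi,\eta):=\mathbf E\,\xi\eta-\mathbf E\xi\,\mathbf E\eta$; $|\xi|_p=(\mathbf E|\xi|^p)^{1/p}$ for $1\le p<\infty$. Random variables are numerical (real or complex) valued. Uniform (Rosenblatt) mixing coefficient: $\alpha(F,G):=\sup\{|\mathbf P(A\cap B)-\mathbf P(A)\mathbf P(B)| : A\in F,\ B\in G\}$. For $b\in(1,\infty]$, $\Psi(b)$ is the set of functions $\psi$ that are finite and continuous on $[1,b)$ (or on $[1,b]$ when $b<\infty$), with $\inf\psi>0$, and extended by $\psi(p):=\infty$ for all other $p$, so that $b=\sup\{p:\psi(p)<\infty\}$. Here $\psi\in\Psi$ means $\psi\in\Psi(b)$ for some $b\in(1,\infty]$ (the values of $b$ for $\psi$ and $\nu$ may differ). The Grand Lebesgue Space $G\psi$ consists of all random variables $\xi$ with finite norm $\|\xi\|_{G\psi}:=\sup\{|\xi|_p/\psi(p):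 p\ge 1,\ \psi(p)<\infty\}$. Let $T=\{(p,q): 1\le p,q<\infty,\ 1/p+1/q<1\}$ and, for $\alpha,\beta\in(0,1]$, $$\Phi[\psi,\nu](\alpha,\beta):=\sup_{(p,q)\in T}\frac{\alpha^{1/p}\beta^{1/q}}{\psi(p)\nu(q)},$$ where $1/\infty=0$. For $\nu\in\Psi(b_2)$ and $s\ge1$ put $\phi^{(s)}[G\nu](\beta):=\sup_{q\in[s,b_2)}\beta^{1/q}/\nu(q)$ (equal to $0$ if $s\ge b_2$), and with $p'=p/(p-1)$ put $$\theta_\beta(p):=\frac{\psi(p)}{\phi^{(p')}[G\nu](\beta)},\qquad p>1,$$ with value $+\infty$ where the denominator vanishes or $\psi(p)=\infty$. The fundamental function of $\theta_\beta$ is $\phi[G\theta_\beta](\delta):=\sup_{p>1}\delta^{1/p}/\theta_\beta(p)$. If the denominators in the claim are $0$, the right-hand sides are read as $+\infty$ (no assertion is made). *)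

(* Defs.v *)
From HB Require Import structures.
From mathcomp Require Import all_boot all_order all_algebra.
From mathcomp Require Import all_classical all_reals all_analysis.
From mathcomp.real_closed Require Export complex.

Set Implicit Arguments.
Unset Strict Implicit.
Unset Printing Implicit Defensive.

Import Order.TTheory GRing.Theory Num.Theory.
Import numFieldNormedType.Exports.

Local Open Scope classical_set_scope.
Local Open Scope ring_scope.
Local Open Scope ereal_scope.

Section RandomVariables.
Context {d : measure_display} {Omega : measurableType d} {R : realType}.
Variable P : probability Omega R.

Definition sub_sigma_field (F : set (set Omega)) : Prop :=
  sigma_algebra [set: Omega] F /\ F `<=` measurable.

(** Real random variables are the [X] with [@complex.Im R \o X] equal to 0.
    The Borel sigma-algebra of C = R x R is the product one, so measurability
    is that of the real and imaginary parts. *)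
Definition measurable_wrt (F : set (set Omega)) (X : Omega -> R[i]) : Prop :=
  forall B : set R, measurable B ->
    F ((@complex.Re R \o X) @^-1` B) /\ F ((@complex.Im R \o X) @^-1` B).

(** As ['E_P[_]] and [fine] are total, this is the expectation only when
    [X] is integrable. *)
Definition cexpectation (X : Omega -> R[i]) : R[i] :=
  Complex (fine 'E_P[@complex.Re R \o X]) (fine 'E_P[@complex.Im R \o X]).

Definition ccovariance (X Y : Omega -> R[i]) : R[i] :=
  (cexpectation (fun w => X w * Y w) - cexpectation X * cexpectation Y)%R.

Definition Lpnorm (p : R) (X : Omega -> R[i]) : \bar R :=
  Lnorm P p%:E (fun w => (Normc.normc (X w))%:E).

Definition alpha_mixing (F G : set (set Omega)) : R :=
  sup [set r : R | exists A, exists B, [/\ F A, G B &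
    r = `|fine (P (A `&` B)) - fine (P A) * fine (P B)|%R]].

Definition GLS_norm (psi : R -> \bar R) (X : Omega -> R[i]) : \bar R :=
  ereal_sup [set Lpnorm p X / psi p | p in [set p | (1 <= p)%R /\ psi p < +oo]].

Definition in_GLS (psi : R -> \bar R) (X : Omega -> R[i]) : Prop :=
  measurable_wrt measurable X /\ GLS_norm psi X < +oo.

End RandomVariables.

Section GeneratingFunctions.
Context {R : realType}.
Implicit Types (b : \bar R) (psi nu : R -> \bar R).

(** The positive infimum excludes the value -oo, so [psi] is finite exactly on
    [dom]. *)
Definition Psi b psi : Prop :=
  let dom := [set p | psi p < +oo] in
  [/\ 1 < b,
      dom = [set p | (1 <= p)%R /\ p%:E < b] \/
        (b < +oo /\ dom = [set p | (1 <= p)%R /\ p%:E <= b]),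
      {within dom, continuous psi} &
      0 < ereal_inf (range psi)].

Definition T_exponents : set (R * R) :=
  [set pq | [/\ 1 <= pq.1, 1 <= pq.2 & pq.1^-1 + pq.2^-1 < 1]%R].

(** In [\bar R], [+oo^-1 = 0]. *)
Definition Phi psi nu (a c : R) : \bar R :=
  ereal_sup [set (a `^ pq.1^-1 * c `^ pq.2^-1)%R%:E / (psi pq.1 * nu pq.2)
            | pq in T_exponents].

Definition phi_trunc b nu (s c : R) : \bar R :=
  if s%:E < b then
    ereal_sup [set (c `^ q^-1)%R%:E / nu q
              | q in [set q | (s <= q)%R /\ q%:E < b]]
  else 0.

(** In [\bar R], [0^-1 = +oo] and [psi p > 0], so this is [+oo] where the
    denominator vanishes. *)
Definition theta psi b nu (c p : R) : \bar R :=
  psi p / phi_trunc b nu (p / (p - 1))%R c.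

Definition fundamental_theta psi b nu (c delta : R) : \bar R :=
  ereal_sup [set (delta `^ p^-1)%R%:E / theta psi b nu c p
            | p in [set p | (1 < p)%R]].

(** Unlike [x / y], this is [+oo] for [y = 0] even when [x = 0]. *)
Definition quotient_or_pinfty (x y : \bar R) : \bar R :=
  if y == 0 then +oo else x / y.

End GeneratingFunctions.

(* Main.v *)
Require Import Defs.
From mathcomp Require Import all_boot all_order all_algebra.
From mathcomp Require Import all_classical all_reals all_analysis.
From mathcomp Require Import measurable_realfun lra ring.

(** The covariance of two variables depends on their joint law only through
    the gaps P(X > s, Y > t) - P(X > s) P(Y > t).  For X, Y >= 0 the double
    layer-cake formula gives

      E XY - EX EY = int int (P(X > s, Y > t) - P(X > s) P(Y > t)) ds dt,

    and the gap at (s, t) is bounded in absolute value by alpha, by P(X > s)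
    and by P(Y > t).  The minimum of these three numbers is the Lebesgue
    measure of the set of those u in ]0, alpha[ at which the upper quantile
    functions of X and Y exceed s and t.  Reading the double layer-cake formula
    backwards on ]0, alpha[ yields Rio's inequality
    |Cov(X, Y)| <= int_0^alpha Q_X Q_Y ([covariance_le_quantiles]).  As Q_X has
    on the unit interval the law of X, Hölder's inequality with exponents p, q
    and the remaining 1 - 1/p - 1/q turns this into

      |Cov(X, Y)| <= alpha^(1 - 1/p - 1/q) |X|_p |Y|_q

    ([nonneg_davydov]).  A real variable is the difference of two nonnegative
    ones, which costs a factor 4 ([real_davydov]).  The real and the imaginary
    part of a complex covariance are each a sum or difference of two real
    covariances, hence are at most 8 times the right-hand side, and the modulus
    is at most 8 sqrt 2 < 12 times it ([complex_davydov]).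

    In the Grand Lebesgue spaces |xi|_p <= ||xi|| psi(p) and
    |eta|_q <= ||eta|| nu(q), so that every pair (p, q) of the index set T
    provides one bound; the supremum defining Phi collects them all.

    For the second form of the bound, fix p.  The supremum over q in Phi runs
    over q > p' with nu(q) finite, the one in the truncated fundamental
    function over p' <= q < b2.  The two ranges differ by end points only, and
    alpha^(1/q) / nu(q) is continuous on the domain of nu, so both suprema agree
    ([Phi_eq_fundamental]). *)

Set Implicit Arguments.
Unset Strict Implicit.
Unset Printing Implicit Defensive.

Import Order.TTheory GRing.Theory Num.Theory.
Import numFieldNormedType.Exports.

Local Open Scope classical_set_scope.
Local Open Scope ring_scope.
Local Open Scope ereal_scope.

(** * Layer-cake formulas *)

Definition superlevel (T : Type) (R : realType) (X : T -> R) (s : R) : set T :=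
  X @^-1` `]s, +oo[.

Section LayerCake.
Context d (T : measurableType d) (R : realType).
Variable mu : {sigma_finite_measure set T -> \bar R}.
Implicit Types (X Y : T -> R) (w : T -> \bar R).

Local Notation leb := (@lebesgue_measure R).
Lemma measurable_superlevel X (s : R) :
  measurable_fun setT X -> measurable (superlevel X s).
Proof.
by move=> mX; rewrite /superlevel -[X in measurable X]setTI; exact: mX.
Qed.

(** Integrated over s it gives w X, integrated over x the integral of w over
    the superlevel set of X. *)
Let kernel X w (z : T * R) : \bar R := w z.1 * (\1_`[0, X z.1[ z.2)%:E.

Let measurable_kernel X w : measurable_fun setT X -> measurable_fun setT w ->
  measurable_fun setT (kernel X w).
Proof.
move=> mX mw; apply: emeasurable_funM; first exact: measurableT_comp.
apply/measurable_EFinP/measurable_indic => /=.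
pose f0 (z : T * R) := (0 <= z.2)%R.
pose f1 (z : T * R) := (z.2 < X z.1)%R.
rewrite [X in measurable X](_ : _ =
    f0 @^-1` [set true] `&` f1 @^-1` [set true]); last first.
  by apply/seteqP; split => z; rewrite in_itv/= => /andP.
apply: measurableI.
- have : measurable_fun setT f0 by exact: measurable_fun_ler.
  by move=> /(_ measurableT [set true]); rewrite setTI; exact.
- have : measurable_fun setT f1.
    by apply: measurable_fun_ltr => //; exact: measurableT_comp.
  by move=> /(_ measurableT [set true]); rewrite setTI; exact.
Qed.

Let tail_kernel X w (s : R) : measurable_fun setT X -> (0 <= s)%R ->
  \int[mu]_x kernel X w (x, s) = \int[mu]_(x in (superlevel X s)) w x.
Proof.
move=> mX s0; rewrite [RHS]integral_mkcond; apply: eq_integral => x _.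
rewrite /kernel /= patchE indicE.
have -> : (s \in `[0%R, X x[%classic) = (x \in (superlevel X s)).
  by apply/idP/idP; rewrite /superlevel !inE/= !in_itv/= s0 ?andbT.
by case: ifPn => _; rewrite ?mule1 ?mule0.
Qed.

Lemma measurable_tail_integral X w : measurable_fun setT X ->
    measurable_fun setT w -> (forall x, 0 <= w x) ->
  measurable_fun (`[0%R, +oo[ : set R) (fun s => \int[mu]_(x in (superlevel X s)) w x).
Proof.
move=> mX mw w0.
apply: (eq_measurable_fun (fun s => \int[mu]_x kernel X w (x, s))).
  by move=> s; rewrite inE/= in_itv/= andbT => s0; rewrite tail_kernel.
apply: measurable_funTS.
apply: (@measurable_fun_fubini_tonelli_G _ _ _ _ _ mu (kernel X w)).
  exact: measurable_kernel.
by move=> z; rewrite /kernel mule_ge0 ?lee_fin.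
Qed.

(** The weight is what allows the formula to be applied twice: once with a
    second variable as the weight, once with the indicator of a superlevel set
    of the first. *)
Lemma weighted_layer_cake X w : measurable_fun setT X ->
    measurable_fun setT w -> (forall x, 0 <= X x)%R -> (forall x, 0 <= w x) ->
  \int[mu]_x (w x * (X x)%:E) =
  \int[leb]_(s in `[0%R, +oo[) \int[mu]_(x in (superlevel X s)) w x.
Proof.
move=> mX mw X0 w0.
have -> : \int[mu]_x (w x * (X x)%:E) =
    \int[mu]_x \int[leb]_s kernel X w (x, s).
  apply: eq_integral => x _; rewrite /kernel /= ge0_integralZl//=.
  - rewrite integral_indic//= setIT lebesgue_measure_itv/= lte_fin.
    have := X0 x; rewrite le_eqVlt => /orP[/eqP <-|->]; first by rewrite ltxx.
    by rewrite sube0.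
  - exact/measurable_EFinP/measurable_indic.
rewrite fubini_tonelli; last 2 first.
  exact: measurable_kernel.
  by move=> z; rewrite /kernel mule_ge0 ?lee_fin.
rewrite [RHS]integral_mkcond; apply: eq_integral => s _; rewrite patchE.
have [s0|s0] := leP 0%R s.
  by rewrite mem_set ?tail_kernel//= in_itv/= s0.
rewrite memNset/=; last by rewrite in_itv/= leNgt s0.
apply: integral0_eq => x _; rewrite /kernel/= indicE memNset ?mule0//=.
by rewrite in_itv/= leNgt s0.
Qed.

End LayerCake.

Section IteratedIntegral.
Context (R : realType).
Implicit Types K : R -> R -> \bar R.

Local Notation leb := (@lebesgue_measure R).
Local Notation D := (`[0%R, +oo[%classic : set R).

Definition iterated_integral K : \bar R :=
  \int[leb]_(s in D) \int[leb]_(t in D) K s t.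

(** The part of joint measurability that makes iterated integrals of
    nonnegative kernels additive and monotone. *)
Definition iterated_measurable K : Prop :=
  [/\ forall s t, 0 <= K s t,
      forall s, measurable_fun D (K s) &
      measurable_fun D (fun s => \int[leb]_(t in D) K s t)].

Lemma iterated_integral_leD K1 K2 K3 :
    iterated_measurable K1 -> iterated_measurable K2 -> iterated_measurable K3 ->
    (forall s t, (0 <= s)%R -> (0 <= t)%R -> K1 s t <= K2 s t + K3 s t) ->
  iterated_integral K1 <= iterated_integral K2 + iterated_integral K3.
Proof.
move=> [K10 K1m K1M] [K20 K2m K2M] [K30 K3m K3M] K123.
have mD : measurable D by [].
rewrite /iterated_integral -ge0_integralD//; last 2 first.
  by move=> s _; exact: integral_ge0.
  by move=> s _; exact: integral_ge0.
apply: ge0_le_integral => //.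
- by move=> s _; exact: integral_ge0.
- exact: emeasurable_funD.
move=> s; rewrite /= in_itv/= andbT => s0.
have [mK1 [mK2 mK3]] := conj (K1m s) (conj (K2m s) (K3m s)).
rewrite -ge0_integralD//.
apply: ge0_le_integral => //; first exact: emeasurable_funD.
by move=> t; rewrite /= in_itv/= andbT => t0; exact: K123.
Qed.

End IteratedIntegral.

Lemma layer_cake d (T : measurableType d) (R : realType)
    (mu : {sigma_finite_measure set T -> \bar R}) (X : T -> R) :
    measurable_fun setT X -> (forall x, 0 <= X x)%R ->
  \int[mu]_x (X x)%:E =
  \int[@lebesgue_measure R]_(s in `[0%R, +oo[) mu (superlevel X s).
Proof.
move=> mX X0; under [LHS]eq_integral do rewrite -[_%:E]mul1e.
rewrite (weighted_layer_cake mu mX (w := cst 1))//.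
by apply: eq_integral => s _; rewrite integral_cst ?mul1e//; exact: measurable_superlevel.
Qed.

Lemma measurable_tail d (T : measurableType d) (R : realType)
    (mu : {sigma_finite_measure set T -> \bar R}) (X : T -> R) :
    measurable_fun setT X ->
  measurable_fun (`[0%R, +oo[ : set R) (fun s => mu (superlevel X s)).
Proof.
move=> mX.
apply: eq_measurable_fun
  (measurable_tail_integral mu mX (w := cst 1) _ _) => //.
by move=> s _; rewrite integral_cst ?mul1e//; exact: measurable_superlevel.
Qed.

Section DoubleLayerCake.
Context d (T : measurableType d) (R : realType).
Variable mu : {sigma_finite_measure set T -> \bar R}.
Variables X Y : T -> R.
Hypotheses (mX : measurable_fun setT X) (mY : measurable_fun setT Y).
Hypotheses (X0 : forall x, (0 <= X x)%R) (Y0 : forall x, (0 <= Y x)%R).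

Local Notation leb := (@lebesgue_measure R).
Local Notation D := (`[0%R, +oo[%classic : set R).

Definition joint_tail (s t : R) : \bar R :=
  mu (superlevel X s `&` superlevel Y t).

Definition product_tail (s t : R) : \bar R :=
  mu (superlevel X s) * mu (superlevel Y t).

Let joint_tailE s t : joint_tail s t =
  \int[mu]_(x in superlevel Y t) (\1_(superlevel X s) x)%:E.
Proof.
by rewrite integral_indic//; exact: measurable_superlevel.
Qed.

Let tail_integralE s : \int[mu]_(x in superlevel X s) (Y x)%:E =
  \int[leb]_(t in D) joint_tail s t.
Proof.
under [RHS]eq_integral do rewrite joint_tailE.
rewrite -(weighted_layer_cake mu mY (w := EFin \o \1_(superlevel X s)))//; last 2 first.
- exact/measurable_EFinP/measurable_indic/measurable_superlevel.
- by move=> x; rewrite lee_fin.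
rewrite integral_mkcond; apply: eq_integral => x _.
by rewrite patchE /= indicE; case: ifPn => _; rewrite ?mul1e ?mul0e.
Qed.

(** The layer-cake formula for X with weight Y, followed by the one for Y with
    the indicator of {X > s} as weight. *)
Lemma double_layer_cake :
  \int[mu]_x (X x * Y x)%:E = iterated_integral joint_tail.
Proof.
under [LHS]eq_integral do rewrite mulrC EFinM.
rewrite (weighted_layer_cake mu mX (w := EFin \o Y))//; last exact/measurable_EFinP.
by apply: eq_integral => s _; rewrite tail_integralE.
Qed.

Lemma iterated_measurable_joint_tail : iterated_measurable joint_tail.
Proof.
split=> [s t|s|]; first exact: measure_ge0.
- apply: eq_measurable_fun (measurable_tail_integral mu mY
    (w := EFin \o \1_(superlevel X s)) _ _).
  + by move=> t _; rewrite joint_tailE.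
  + exact/measurable_EFinP/measurable_indic/measurable_superlevel.
  + by move=> x; rewrite lee_fin.
- apply: eq_measurable_fun (measurable_tail_integral mu mX (w := EFin \o Y) _ _).
  + by move=> s _; rewrite tail_integralE.
  + exact/measurable_EFinP.
  + by move=> x; rewrite lee_fin.
Qed.

Let product_tail_inner s : \int[leb]_(t in D) product_tail s t =
  mu (superlevel X s) * \int[mu]_x (Y x)%:E.
Proof.
have mt : measurable_fun D (fun t => mu (superlevel Y t)) by exact: measurable_tail.
rewrite (layer_cake mu mY Y0) -ge0_integralZl//.
Qed.

Lemma product_layer_cake :
  (\int[mu]_x (X x)%:E) * (\int[mu]_x (Y x)%:E) = iterated_integral product_tail.
Proof.
have ms : measurable_fun D (fun t => mu (superlevel X t)) by exact: measurable_tail.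
rewrite /iterated_integral; under [RHS]eq_integral do rewrite product_tail_inner.
rewrite ge0_integralZr//; last by apply: integral_ge0 => x _; rewrite lee_fin.
by rewrite (layer_cake mu mX X0).
Qed.

Lemma iterated_measurable_product_tail : iterated_measurable product_tail.
Proof.
split=> [s t|s|]; first exact: mule_ge0.
- by apply: measurable_funeM; exact: measurable_tail.
- apply: (eq_measurable_fun (fun s => \int[mu]_x (Y x)%:E * mu (superlevel X s))).
    by move=> s _; rewrite product_tail_inner muleC.
  by apply: measurable_funeM; exact: measurable_tail.
Qed.

End DoubleLayerCake.

(** * Upper quantiles on the Lebesgue interval *)

Section Quantile.
Context d (T : measurableType d) (R : realType).
Variable P : probability T R.
Variable X : T -> R.
Hypothesis mX : measurable_fun setT X.

Definition tail (s : R) : R := fine (P (superlevel X s)).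

(** The generalized inverse of the tail function. For u <= 0 the set may be
    unbounded, and the value 0 keeps the function nonnegative and measurable
    on the whole line. *)
Definition upper_quantile (u : R) : R :=
  if (0 < u)%R then sup [set s | (0 <= s)%R /\ (u < tail s)%R] else 0%R.

Let Xmf : {mfun T >-> R} := mfun_Sub (mem_set mX : X \in mfun).

Lemma tailK s : (tail s)%:E = P (superlevel X s).
Proof. by rewrite fineK// fin_num_measure//; exact: measurable_superlevel. Qed.

Lemma tail_ge0 s : (0 <= tail s)%R.
Proof. by rewrite fine_ge0. Qed.

Lemma tail_le1 s : (tail s <= 1)%R.
Proof.
by rewrite -lee_fin tailK; apply: probability_le1; exact: measurable_superlevel.
Qed.

Lemma tail_noninc s t : (s <= t)%R -> (tail t <= tail s)%R.
Proof.
move=> st; rewrite -lee_fin !tailK le_measure ?inE//; [exact: measurable_superlevel..|].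
by move=> x; rewrite /superlevel/= !in_itv/= !andbT; exact: le_lt_trans.
Qed.

Let tail_right_open s u : (u < tail s)%R -> exists2 t, (s < t)%R & (u < tail t)%R.
Proof.
move=> us.
have : tail r @[r --> s^'+] --> tail s.
  by apply: fine_cvg; rewrite tailK; exact: (@ccdf_right_continuous _ _ _ P Xmf).
move=> /cvgr_gt /(_ _ us) ut.
near s^'+ => t; exists t; first by near: t; exact: nbhs_right_gt.
by near: t.
Unshelve. all: by end_near. Qed.

Let tail_vanishes u : (0 < u)%R -> exists t, (tail t <= u)%R.
Proof.
move=> u0.
have : tail r @[r --> +oo%R] --> 0%R.
  exact/fine_cvg/(@cvg_ccdfy0 _ _ _ P Xmf).
move=> /cvgr_lt /(_ _ u0) ut.
near (+oo%R : set_system R) => t; exists t; rewrite ltW//.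
by near: t.
Unshelve. all: by end_near. Qed.

(** The Galois connection between a tail function and its inverse: from left
    to right by monotonicity, from right to left by right-continuity of the
    tail, while its vanishing at infinity makes the supremum a real number. *)
Lemma lt_upper_quantile s u : (0 <= s)%R -> (0 < u)%R ->
  (s < upper_quantile u)%R = (u < tail s)%R.
Proof.
move=> s0 u0; rewrite /upper_quantile u0.
set S := [set s | _]; apply/idP/idP => [sS|us].
  have [S0|] := pselect (S !=set0); last first.
    by move/set0P/negP; rewrite negbK => /eqP S0; move: sS; rewrite S0 sup0 ltNge s0.
  have [t [_ ut] st] := sup_gt S0 sS.
  by rewrite (lt_le_trans ut)// tail_noninc// ltW.
have [t st ut] := tail_right_open us.
rewrite (lt_le_trans st)// ub_le_sup//; last by split=> //; rewrite (le_trans s0)// ltW.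
have [v vu] := tail_vanishes u0.
exists v => r [_ ur]; rewrite leNgt; apply/negP => vr.
by have := tail_noninc (ltW vr); rewrite leNgt (le_lt_trans vu).
Qed.

Lemma upper_quantile_ge0 u : (0 <= upper_quantile u)%R.
Proof.
rewrite leNgt; apply/negP => /[dup] + q0; rewrite /upper_quantile.
case: ifPn => [u0|_]; last by rewrite ltxx.
set S := [set s | _].
have [[s [s0 us]]|] := pselect (S !=set0); last first.
  by move/set0P/negP; rewrite negbK => /eqP ->; rewrite sup0 ltxx.
have : (s < upper_quantile u)%R by rewrite lt_upper_quantile.
by move=> /(le_lt_trans s0) /lt_trans /(_ q0); rewrite ltxx.
Qed.

Lemma superlevel_upper_quantile s : (0 <= s)%R ->
  superlevel upper_quantile s = `]0%R, tail s[%classic.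
Proof.
move=> s0; apply/seteqP; split => u; rewrite /superlevel/= !in_itv/= andbT.
  have [u0|u0] := ltP 0%R u; first by rewrite lt_upper_quantile.
  by rewrite /upper_quantile [(0 < u)%R]ltNge u0/= ltNge s0.
by move=> /andP[u0]; rewrite lt_upper_quantile.
Qed.

Lemma measurable_upper_quantile : measurable_fun setT upper_quantile.
Proof.
move=> mT; apply: (measurability _ (RGenOInfty.measurableE R)) => //.
move=> /= _ [_ [s ->] <-]; apply: measurableI => //.
have [s0|s0] := leP 0%R s.
  by rewrite -/(superlevel upper_quantile s) superlevel_upper_quantile.
rewrite [X in measurable X](_ : _ = setT)//.
apply/seteqP; split => // u _ /=.
by rewrite in_itv/= andbT (lt_le_trans s0)// upper_quantile_ge0.
Qed.

End Quantile.

Section Coupling.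
Context d (T : measurableType d) (R : realType).
Variable P : probability T R.
Variable (alpha : R).

Local Notation leb := (@lebesgue_measure R).
Local Notation D := (`]0%R, alpha[%classic : set R).

Let D_finite : leb D < +oo.
Proof.
by rewrite lebesgue_measure_itv/=; case: ifPn => _; rewrite ?ltry// -EFinB ltry.
Qed.

Let mD : measurable (D : set (measurableTypeR R)). Proof. by []. Qed.

(** Lebesgue measure on ]0, alpha[, where the quantile functions of all
    variables live together: large values of different variables are all put
    near 0, and this coupling makes the mean of their product largest. *)
Definition lebesgue_below : {finite_measure set (measurableTypeR R) -> \bar R} :=
  @mfrestr _ (measurableTypeR R) R D leb mD D_finite.

(** The superlevel sets of upper quantiles are intervals starting at 0, so
    they are nested and their intersection is the shortest one. *)
Lemma lebesgue_below_joint_tail (X Y : T -> R) s t : (0 <= alpha)%R ->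
  measurable_fun setT X -> measurable_fun setT Y -> (0 <= s)%R -> (0 <= t)%R ->
  lebesgue_below (superlevel (upper_quantile P X) s `&` superlevel (upper_quantile P Y) t)
  = (Num.min alpha (Num.min (tail P X s) (tail P Y t)))%:E.
Proof.
move=> a0 mX mY s0 t0.
rewrite /lebesgue_below/= /mfrestr/= /mrestr !superlevel_upper_quantile//.
set m := Num.min _ _.
have m0 : (0 <= m)%R by rewrite !le_min a0 !tail_ge0.
rewrite [X in leb X](_ : _ = `]0%R, m[%classic).
  rewrite lebesgue_measure_itv/= lte_fin; case: ifPn => [_|]; first by rewrite sube0.
  by rewrite -leNgt => m0'; congr EFin; apply/eqP; rewrite eq_le m0 m0'.
apply/seteqP; split => u; rewrite /= !in_itv/= !lt_min.
  by move=> [[/andP[-> ->] /andP[_ ->]] /andP[_ ->]].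
by move=> /andP[-> /and3P[-> -> ->]].
Qed.

Lemma lebesgue_below_tail_le (X : T -> R) s : (0 <= alpha)%R ->
  measurable_fun setT X -> (0 <= s)%R ->
  lebesgue_below (superlevel (upper_quantile P X) s) <= P (superlevel X s).
Proof.
move=> a0 mX s0; rewrite -[superlevel _ s]setIid lebesgue_below_joint_tail//.
by rewrite -tailK// lee_fin !ge_min lexx !orbT.
Qed.

Lemma lebesgue_below_setT : (0 <= alpha)%R -> lebesgue_below setT = alpha%:E.
Proof.
move=> a0; rewrite /lebesgue_below/= /mfrestr/= /mrestr setTI.
rewrite lebesgue_measure_itv/= lte_fin; case: ifPn => [_|]; first by rewrite sube0.
by rewrite -leNgt => m0'; congr EFin; apply/eqP; rewrite eq_le a0 m0'.
Qed.

End Coupling.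

(** * Comparison of Lebesgue norms *)

Section LnormComparison.
Context (R : realType).

(** Hölder's inequality for |f|^p and the constant 1, with exponent q / p. *)
Lemma le_Lnorm_finite d (T : measurableType d) (mu : {measure set T -> \bar R})
    (f : T -> R) (p q : R) : measurable_fun setT f -> (0 < p)%R -> (p < q)%R ->
  'N[mu]_p%:E[EFin \o f] <=
  'N[mu]_q%:E[EFin \o f] * mu setT `^ (p^-1 - q^-1).
Proof.
move=> mf p0 pq; have q0 := lt_trans p0 pq.
have pN0 : p != 0%R by rewrite gt_eqF.
have qN0 : q != 0%R by rewrite gt_eqF.
pose r := (q / p)%R; pose r' := (1 - p / q)^-1%R.
have r0 : (0 < r)%R by rewrite divr_gt0.
have r'0 : (0 < r')%R by rewrite invr_gt0 subr_gt0 ltr_pdivrMr// mul1r.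
have rr' : (r^-1 + r'^-1 = 1)%R by rewrite /r /r' invf_div invrK addrC subrK.
have mfp : measurable_fun setT (fun x => `|f x| `^ p)%R.
  apply: (@measurableT_comp _ _ _ _ _ _ (@powR R ^~ p)) => //.
  exact: measurableT_comp.
have := hoelder mu mfp (@measurable_cst _ _ T R setT 1%R) r0 r'0 rr'.
rewrite Lnorm1 Lnorm_cst1 invrK.
under eq_integral do rewrite /= mulr1 norm_powR// normr_id.
have -> : 'N[mu]_r%:E[EFin \o (fun x => (`|f x| `^ p)%R)] =
    'N[mu]_q%:E[EFin \o f] `^ p.
  rewrite unlock -poweRrM invf_div mulrC; congr (_ `^ _).
  apply: eq_integral => x _ /=.
  by rewrite norm_powR// normr_id -powRrM mulrCA divff ?mulr1.
have -> : \int[mu]_x (`|f x| `^ p)%:E = 'N[mu]_p%:E[EFin \o f] `^ p.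
  by rewrite poweR_Lnorm.
move=> h.
have {}h : ('N[mu]_p%:E[EFin \o f] `^ p) `^ p^-1 <=
    ('N[mu]_q%:E[EFin \o f] `^ p * mu setT `^ (1 - p / q)) `^ p^-1.
  apply: gt0_ler_poweR => //; first by rewrite invr_ge0 ltW.
    by rewrite in_itv/= leey poweR_ge0.
  by rewrite in_itv/= leey mule_ge0 ?poweR_ge0.
move: h; rewrite poweRM ?poweR_ge0// -!poweRrM divff// !poweRe1 ?Lnorm_ge0//.
by congr (_ <= _ * _ `^ _); field; rewrite pN0 qN0.
Qed.

Lemma superlevel_powR (T : Type) (X : T -> R) (p s : R) :
  (forall x, 0 <= X x)%R -> (0 < p)%R -> (0 <= s)%R ->
  superlevel (fun x => X x `^ p)%R s = superlevel X (s `^ p^-1).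
Proof.
move=> X0 p0 s0; apply/seteqP; split => x; rewrite /superlevel/= !in_itv/= !andbT => h.
- rewrite -[X in (_ < X)%R]powRr1// -(@mulfV _ p) ?gt_eqF// powRrM.
  by rewrite gt0_ltr_powR ?invr_gt0// nnegrE ?powR_ge0.
- rewrite -[X in (X < _)%R]powRr1// -(@mulVf _ p) ?gt_eqF// powRrM.
  by rewrite gt0_ltr_powR// nnegrE ?powR_ge0.
Qed.

(** By the layer-cake formula applied to p-th powers, an L^p norm is an
    increasing function of the tail alone. *)
Lemma le_Lnorm_tail d1 d2 (T : measurableType d1) (U : measurableType d2)
    (mu : {sigma_finite_measure set T -> \bar R})
    (nu : {sigma_finite_measure set U -> \bar R})
    (X : T -> R) (f : U -> R) (p : R) :
    measurable_fun setT X -> measurable_fun setT f ->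
    (forall x, 0 <= X x)%R -> (forall u, 0 <= f u)%R -> (0 < p)%R ->
    (forall s, (0 <= s)%R -> nu (superlevel f s) <= mu (superlevel X s)) ->
  'N[nu]_p%:E[EFin \o f] <= 'N[mu]_p%:E[EFin \o X].
Proof.
move=> mX mf X0 f0 p0 tails.
have mp d (V : measurableType d) (g : V -> R) : measurable_fun setT g ->
    measurable_fun setT (fun x => g x `^ p)%R.
  by move=> mg; exact: (@measurableT_comp _ _ _ _ _ _ (@powR R ^~ p)).
have NE d (V : measurableType d) (m : {measure set V -> \bar R}) (g : V -> R) :
    (forall x, 0 <= g x)%R ->
    'N[m]_p%:E[EFin \o g] = (\int[m]_x (g x `^ p)%:E) `^ p^-1.
  move=> g0; rewrite unlock; congr (_ `^ _).
  by apply: eq_integral => x _; rewrite /= ger0_norm.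
rewrite !NE//; apply: gt0_ler_poweR => //.
- by rewrite invr_ge0 ltW.
- by rewrite in_itv/= leey andbT integral_ge0// => x _; rewrite lee_fin powR_ge0.
- by rewrite in_itv/= leey andbT integral_ge0// => x _; rewrite lee_fin powR_ge0.
rewrite (layer_cake nu (mp _ _ _ mf)); last by move=> u; rewrite powR_ge0.
rewrite (layer_cake mu (mp _ _ _ mX)); last by move=> x; rewrite powR_ge0.
apply: ge0_le_integral => //.
- by apply: measurable_tail; exact: mp.
- by apply: measurable_tail; exact: mp.
move=> s; rewrite /= in_itv/= andbT => s0.
by rewrite !superlevel_powR// tails// powR_ge0.
Qed.

End LnormComparison.

(** * Covariance of nonnegative mixing variables *)

Section NonnegativeCovariance.
Context d (T : measurableType d) (R : realType).
Variable P : probability T R.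
Variables (alpha : R) (X Y : T -> R).
Hypothesis alpha_ge0 : (0 <= alpha)%R.
Hypotheses (mX : measurable_fun setT X) (mY : measurable_fun setT Y).
Hypotheses (X0 : forall x, (0 <= X x)%R) (Y0 : forall x, (0 <= Y x)%R).
Hypothesis mixing : forall s t,
  (`|fine (P (superlevel X s `&` superlevel Y t)) - tail P X s * tail P Y t|
   <= alpha)%R.

Local Notation m := (lebesgue_below alpha).
Local Notation QX := (upper_quantile P X).
Local Notation QY := (upper_quantile P Y).

Let mQX : measurable_fun setT (QX : measurableTypeR R -> R).
Proof. exact: measurable_upper_quantile. Qed.

Let mQY : measurable_fun setT (QY : measurableTypeR R -> R).
Proof. exact: measurable_upper_quantile. Qed.

Let joint (s t : R) := fine (P (superlevel X s `&` superlevel Y t)).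

Let jointK s t : (joint s t)%:E = joint_tail P X Y s t.
Proof.
rewrite fineK// fin_num_measure//.
by apply: measurableI; exact: measurable_superlevel.
Qed.

Let joint_bounds s t : [/\ (0 <= joint s t)%R, (joint s t <= tail P X s)%R &
  (joint s t <= tail P Y t)%R].
Proof.
split; first exact: fine_ge0.
- by rewrite -lee_fin jointK tailK// measureIl//; exact: measurable_superlevel.
- by rewrite -lee_fin jointK tailK// measureIr//; exact: measurable_superlevel.
Qed.

(** Both P(X > s, Y > t) and P(X > s) P(Y > t) lie between 0 and each of the
    two tails, which bounds their difference by the tails; the mixing
    hypothesis bounds it by alpha. *)
Let gap s t : (0 <= s)%R -> (0 <= t)%R ->
  joint_tail P X Y s t <= product_tail P X Y s t + joint_tail m QX QY s t /\
  product_tail P X Y s t <= joint_tail P X Y s t + joint_tail m QX QY s t.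
Proof.
move=> s0 t0.
have [j0 jX jY] := joint_bounds s t.
have := mixing s t; rewrite -/(joint s t) ler_norml => /andP[lo hi].
have [a0 a1] := (tail_ge0 P X s, tail_le1 P mX s).
have [b0 b1] := (tail_ge0 P Y t, tail_le1 P mY t).
have -> : product_tail P X Y s t = (tail P X s * tail P Y t)%:E.
  by rewrite EFinM !tailK.
have -> : joint_tail m QX QY s t =
    (Num.min alpha (Num.min (tail P X s) (tail P Y t)))%:E.
  exact: lebesgue_below_joint_tail.
rewrite -jointK -!EFinD !lee_fin.
by split; rewrite -lerBlDl !le_min; apply/and3P; split; nra.
Qed.

(** Rio's covariance inequality. It is stated as two inequalities between
    extended reals because E XY is only known to be finite as a consequence. *)
Lemma covariance_le_quantiles :
  \int[P]_x (X x * Y x)%:E <= \int[P]_x (X x)%:E * \int[P]_x (Y x)%:E +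
    \int[m]_u (QX u * QY u)%:E /\
  \int[P]_x (X x)%:E * \int[P]_x (Y x)%:E <= \int[P]_x (X x * Y x)%:E +
    \int[m]_u (QX u * QY u)%:E.
Proof.
have Q0 := upper_quantile_ge0 P.
rewrite product_layer_cake// !double_layer_cake//; [|exact: Q0|exact: Q0].
have iJ := iterated_measurable_joint_tail P mX mY Y0.
have iP := iterated_measurable_product_tail P mX mY Y0.
have iQ := iterated_measurable_joint_tail m mQX mQY (Q0 _ mY).
by split; apply: iterated_integral_leD => // s t s0 t0; have [] := gap s0 t0.
Qed.

(** Hölder's inequality on ]0, alpha[ with p and its conjugate p', which is
    below q; passing from p' to q costs the power 1/p' - 1/q of the total mass
    alpha. *)
Lemma quantiles_le_Lnorm p q : (0 < p)%R -> (0 < q)%R -> (p^-1 + q^-1 < 1)%R ->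
  \int[m]_u (QX u * QY u)%:E <=
  'N[P]_p%:E[EFin \o X] * 'N[P]_q%:E[EFin \o Y] * (alpha `^ (1 - p^-1 - q^-1))%:E.
Proof.
move=> p0 q0 pq.
have Q0 := upper_quantile_ge0 P.
have ip0 : (0 < p^-1)%R by rewrite invr_gt0.
have iq0 : (0 < q^-1)%R by rewrite invr_gt0.
pose p' := (1 - p^-1)^-1%R.
have p'0 : (0 < p')%R by rewrite invr_gt0; lra.
have p'q : (p' < q)%R.
  by rewrite -ltf_pV2// invrK; lra.
have NX : 'N[m]_p%:E[EFin \o QX] <= 'N[P]_p%:E[EFin \o X].
  apply: (le_Lnorm_tail mX mQX) => // [u|s s0]; first exact: Q0.
  exact: lebesgue_below_tail_le.
have NY : 'N[m]_q%:E[EFin \o QY] <= 'N[P]_q%:E[EFin \o Y].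
  apply: (le_Lnorm_tail mY mQY) => // [u|s s0]; first exact: Q0.
  exact: lebesgue_below_tail_le.
have pp' : (p^-1 + p'^-1 = 1)%R by rewrite /p' invrK addrC subrK.
have -> : \int[m]_u (QX u * QY u)%:E = 'N[m]_1[EFin \o (QX \* QY)%R].
  rewrite Lnorm1; apply: eq_integral => u _.
  by rewrite /= ger0_norm// mulr_ge0// Q0.
apply: (le_trans (hoelder m mQX mQY p0 p'0 pp')).
rewrite -muleA; apply: lee_pmul; rewrite ?Lnorm_ge0//.
have mE : m setT `^ (p'^-1 - q^-1) = (alpha `^ (1 - p^-1 - q^-1))%:E.
  by rewrite lebesgue_below_setT// poweR_EFin /p' invrK.
have : 'N[m]_p'%:E[EFin \o QY] <=
    'N[m]_q%:E[EFin \o QY] * (alpha `^ (1 - p^-1 - q^-1))%:E.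
  by rewrite -mE; exact: le_Lnorm_finite.
move=> /le_trans; apply.
by apply: lee_pmul; rewrite ?Lnorm_ge0// lee_fin powR_ge0.
Qed.

End NonnegativeCovariance.

(** * Covariance of real mixing variables *)

Lemma le_Lnorm d (T : measurableType d) (R : realType)
    (mu : {measure set T -> \bar R}) (f g : T -> R) (p : R) :
    measurable_fun setT f -> measurable_fun setT g -> (0 < p)%R ->
    (forall x, `|f x| <= `|g x|)%R ->
  'N[mu]_p%:E[EFin \o f] <= 'N[mu]_p%:E[EFin \o g].
Proof.
move=> mf mg p0 fg; rewrite unlock.
have mp (h : T -> R) : measurable_fun setT h ->
    measurable_fun setT (fun x => (`|h x| `^ p)%:E).
  move=> mh; apply/measurable_EFinP.
  apply: (@measurableT_comp _ _ _ _ _ _ (@powR R ^~ p)) => //.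
  exact: measurableT_comp.
apply: gt0_ler_poweR.
- by rewrite invr_ge0 ltW.
- by rewrite in_itv/= leey andbT integral_ge0// => x _; rewrite lee_fin powR_ge0.
- by rewrite in_itv/= leey andbT integral_ge0// => x _; rewrite lee_fin powR_ge0.
apply: ge0_le_integral => //.
- by move=> x _; rewrite lee_fin powR_ge0.
- exact: mp.
- exact: mp.
by move=> x _; rewrite lee_fin ge0_ler_powR ?nnegrE// ltW.
Qed.

Section RealCovariance.
Context d (T : measurableType d) (R : realType).
Variable P : probability T R.
Implicit Types X Y : T -> R.

Definition rcov X Y : R :=
  (\int[P]_x (X x * Y x) - (\int[P]_x X x) * (\int[P]_x Y x))%R.

(** The three conditions under which [rcov] is a genuine covariance; together
    they are stable under differences in either argument. *)
Definition integrable_triple X Y : Prop :=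
  [/\ P.-integrable setT (EFin \o X), P.-integrable setT (EFin \o Y) &
      P.-integrable setT (EFin \o (X \* Y)%R)].

Lemma rcovBl X X' Y : integrable_triple X Y -> integrable_triple X' Y ->
  rcov (X \- X')%R Y = (rcov X Y - rcov X' Y)%R.
Proof.
move=> [iX iY iXY] [iX' _ iX'Y]; rewrite /rcov.
have -> : (\int[P]_x ((X \- X') x * Y x) =
    \int[P]_x (X x * Y x) - \int[P]_x (X' x * Y x))%R.
  rewrite -RintegralB//; apply: eq_Rintegral => x _.
  by rewrite /= mulrBl.
have -> : (\int[P]_x (X \- X')%R x = \int[P]_x X x - \int[P]_x X' x)%R.
  by rewrite -RintegralB.
by ring.
Qed.

Lemma rcovC X Y : rcov X Y = rcov Y X.
Proof.
rewrite /rcov mulrC; congr (_ - _)%R.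
by apply: eq_Rintegral => x _; rewrite mulrC.
Qed.

Lemma integrable_tripleC X Y : integrable_triple X Y -> integrable_triple Y X.
Proof.
move=> [iX iY iXY]; split => //; apply: eq_integrable iXY => // x _.
by rewrite /= mulrC.
Qed.

Lemma integrable_tripleBl X X' Y : integrable_triple X Y ->
  integrable_triple X' Y -> integrable_triple (X \- X')%R Y.
Proof.
move=> [iX iY iXY] [iX' _ iX'Y]; split => //.
- exact: (integrableB measurableT iX iX').
- apply: eq_integrable (integrableB measurableT iXY iX'Y) => // x _.
  by rewrite /= mulrBl.
Qed.

End RealCovariance.

Section DavydovReal.
Context d (T : measurableType d) (R : realType).
Variable P : probability T R.
Variables (alpha p q : R).
Hypothesis alpha_ge0 : (0 <= alpha)%R.
Hypotheses (p0 : (0 < p)%R) (q0 : (0 < q)%R) (pq : (p^-1 + q^-1 < 1)%R).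
Implicit Types X Y : T -> R.

Local Notation rate := (alpha `^ (1 - p^-1 - q^-1))%R.

Definition mixing_pair X Y : Prop :=
  forall B C : set R, measurable B -> measurable C ->
  (`|fine (P (X @^-1` B `&` Y @^-1` C)) -
     fine (P (X @^-1` B)) * fine (P (Y @^-1` C))| <= alpha)%R.

Lemma mixing_pair_comp X Y (f g : R -> R) : measurable_fun setT f ->
  measurable_fun setT g -> mixing_pair X Y -> mixing_pair (f \o X) (g \o Y).
Proof.
move=> mf mg XY B C mB mC; apply: (XY (f @^-1` B) (g @^-1` C)).
- by rewrite -[X in measurable X]setTI; exact: mf.
- by rewrite -[X in measurable X]setTI; exact: mg.
Qed.

(** Davydov's inequality with constant 1, together with the integrability of
    the product. *)
Lemma nonneg_davydov X Y (A B : R) :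
    measurable_fun setT X -> measurable_fun setT Y ->
    (forall x, 0 <= X x)%R -> (forall x, 0 <= Y x)%R -> mixing_pair X Y ->
    P.-integrable setT (EFin \o X) -> P.-integrable setT (EFin \o Y) ->
    'N[P]_p%:E[EFin \o X] <= A%:E -> 'N[P]_q%:E[EFin \o Y] <= B%:E ->
  integrable_triple P X Y /\ (`|rcov P X Y| <= A * B * rate)%R.
Proof.
move=> mX mY X0 Y0 XY iX iY NX NY.
have mix s t : (`|fine (P (superlevel X s `&` superlevel Y t)) -
    tail P X s * tail P Y t| <= alpha)%R by exact: XY.
have [h1 h2] := covariance_le_quantiles alpha_ge0 mX mY X0 Y0 mix.
have h3 := quantiles_le_Lnorm P alpha_ge0 mX mY X0 Y0 p0 q0 pq.
set Q := (X in _ <= _ + X) in h1 h2.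
have QM : Q <= (A * B * rate)%:E.
  apply: (le_trans h3); rewrite !EFinM; apply: lee_pmul => //.
  - by rewrite mule_ge0// Lnorm_ge0.
  - by rewrite lee_fin powR_ge0.
  - by apply: lee_pmul; rewrite ?Lnorm_ge0.
have eX : \int[P]_x (X x)%:E = (\int[P]_x X x)%R%:E.
  by rewrite fineK//; exact: integrable_fin_num.
have eY : \int[P]_x (Y x)%:E = (\int[P]_x Y x)%R%:E.
  by rewrite fineK//; exact: integrable_fin_num.
have XYle : \int[P]_x (X x * Y x)%:E <=
    (\int[P]_x X x * \int[P]_x Y x + A * B * rate)%R%:E.
  by apply: (le_trans h1); rewrite eX eY EFinD EFinM leeD2l.
have iXY : P.-integrable setT (EFin \o (X \* Y)%R).
  apply/integrableP; split; first exact/measurable_EFinP/measurable_funM.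
  under eq_integral do rewrite gee0_abs ?lee_fin ?mulr_ge0//.
  by rewrite (le_lt_trans XYle)// ltry.
have eXY : \int[P]_x (X x * Y x)%:E = (\int[P]_x (X x * Y x))%R%:E.
  by rewrite fineK//; exact: integrable_fin_num.
split; first by split.
rewrite eXY lee_fin in XYle.
have : ((\int[P]_x X x * \int[P]_x Y x)%R%:E <=
    (\int[P]_x (X x * Y x) + A * B * rate)%R%:E).
  rewrite EFinM -eX -eY; apply: (le_trans h2).
  by rewrite eXY EFinD leeD2l.
rewrite lee_fin => hl; rewrite /rcov ler_norml; apply/andP; split; lra.
Qed.

(** Bilinearity of the covariance in the positive and negative parts, whose
    L^p norms are at most that of the variable; measurable functions of a mixing
    pair are a mixing pair. *)
Lemma real_davydov X Y (A B : R) :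
    measurable_fun setT X -> measurable_fun setT Y -> mixing_pair X Y ->
    P.-integrable setT (EFin \o X) -> P.-integrable setT (EFin \o Y) ->
    'N[P]_p%:E[EFin \o X] <= A%:E -> 'N[P]_q%:E[EFin \o Y] <= B%:E ->
  integrable_triple P X Y /\ (`|rcov P X Y| <= 4 * (A * B * rate))%R.
Proof.
move=> mX mY XY iX iY NX NY.
pose pos (x : R) := Num.max x 0%R; pose neg (x : R) := Num.max (- x)%R 0%R.
have mpos : measurable_fun setT pos by exact: measurable_funrpos.
have mneg : measurable_fun setT neg by exact: measurable_funrneg.
have part (f : R -> R) (Z : T -> R) : measurable_fun setT f -> measurable_fun setT Z ->
    measurable_fun setT (f \o Z) by move=> mf mZ; exact: (measurableT_comp mf mZ).
have posneg x : x = (pos x - neg x)%R.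
  by rewrite /pos /neg; have [?|?] := leP x 0%R; have [?|?] := leP (- x)%R 0%R; lra.
have pos_bound x : (0 <= pos x <= `|x|)%R.
  by rewrite /pos le_max lexx orbT ge_max ler_norm normr_ge0.
have neg_bound x : (0 <= neg x <= `|x|)%R.
  by rewrite /neg le_max lexx orbT ge_max -normrN ler_norm normr_ge0.
have key (f g : R -> R) : measurable_fun setT f -> measurable_fun setT g ->
    (forall x, 0 <= f x <= `|x|)%R -> (forall x, 0 <= g x <= `|x|)%R ->
    integrable_triple P (f \o X) (g \o Y) /\
    (`|rcov P (f \o X) (g \o Y)| <= A * B * rate)%R.
  move=> mf mg fb gb.
  have bound (k : R -> R) (Z : T -> R) x : (forall x, 0 <= k x <= `|x|)%R ->
      (`|(k \o Z) x| <= `|Z x|)%R.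
    by move=> kb; have /andP[k0 k1] := kb (Z x); rewrite /= ger0_norm.
  have mfX := part _ _ mf mX; have mgY := part _ _ mg mY.
  apply: nonneg_davydov => //.
  - by move=> x; have /andP[] := fb (X x).
  - by move=> x; have /andP[] := gb (Y x).
  - exact: mixing_pair_comp.
  - apply: le_integrable iX => //; first exact/measurable_EFinP.
    by move=> x _; rewrite lee_fin; exact: bound.
  - apply: le_integrable iY => //; first exact/measurable_EFinP.
    by move=> x _; rewrite lee_fin; exact: bound.
  - apply: le_trans NX; apply: le_Lnorm => // x; exact: bound.
  - apply: le_trans NY; apply: le_Lnorm => // x; exact: bound.
have [tpp cpp] := key _ _ mpos mpos pos_bound pos_bound.
have [tpn cpn] := key _ _ mpos mneg pos_bound neg_bound.
have [tnp cnp] := key _ _ mneg mpos neg_bound pos_bound.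
have [tnn cnn] := key _ _ mneg mneg neg_bound neg_bound.
have XE : X = ((pos \o X) \- (neg \o X))%R by apply/funext => x /=; exact: posneg.
have YE : Y = ((pos \o Y) \- (neg \o Y))%R by apply/funext => x /=; exact: posneg.
have tp := integrable_tripleBl tpp tnp; rewrite -XE in tp.
have tn := integrable_tripleBl tpn tnn; rewrite -XE in tn.
have cp := rcovBl tpp tnp; rewrite -XE in cp.
have cn := rcovBl tpn tnn; rewrite -XE in cn.
have := integrable_tripleBl (integrable_tripleC tp) (integrable_tripleC tn).
have := rcovBl (integrable_tripleC tp) (integrable_tripleC tn).
rewrite -YE => cE /integrable_tripleC t; split => //.
rewrite rcovC cE [rcov P _ X]rcovC [rcov P (_ \o Y) X]rcovC cp cn.
move: cpp cpn cnp cnn; rewrite !ler_norml.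
by move=> /andP[? ?] /andP[? ?] /andP[? ?] /andP[? ?]; apply/andP; split; lra.
Qed.

End DavydovReal.

(** * Covariance of complex mixing variables *)

Section ComplexParts.
Context (R : realType).
Implicit Types x y : R[i].

Local Notation Re := (@complex.Re R).
Local Notation Im := (@complex.Im R).

Lemma Re_mulc x y : Re (x * y)%R = (Re x * Re y - Im x * Im y)%R.
Proof. by case: x => a b; case: y => c e. Qed.

Lemma Im_mulc x y : Im (x * y)%R = (Re x * Im y + Im x * Re y)%R.
Proof. by case: x => a b; case: y => c e. Qed.

Lemma Re_subc x y : Re (x - y)%R = (Re x - Re y)%R.
Proof. by case: x => a b; case: y => c e. Qed.

Lemma Im_subc x y : Im (x - y)%R = (Im x - Im y)%R.
Proof. by case: x => a b; case: y => c e. Qed.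

Lemma normcE x : Normc.normc x = Num.sqrt (Re x ^+ 2 + Im x ^+ 2)%R.
Proof. by case: x. Qed.

Lemma normc_ge0 x : (0 <= Normc.normc x)%R.
Proof. by rewrite normcE sqrtr_ge0. Qed.

Lemma Re_le_normc x : (`|Re x| <= Normc.normc x)%R.
Proof. by rewrite normcE -sqrtr_sqr ler_wsqrtr// lerDl sqr_ge0. Qed.

Lemma Im_le_normc x : (`|Im x| <= Normc.normc x)%R.
Proof. by rewrite normcE -sqrtr_sqr ler_wsqrtr// lerDr sqr_ge0. Qed.

(** Here 8 sqrt 2 < 12, since 2 * 8^2 = 128 < 144 = 12^2. *)
Lemma normc_le_parts x (r : R) : (`|Re x| <= 8 * r)%R -> (`|Im x| <= 8 * r)%R ->
  (Normc.normc x <= 12 * r)%R.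
Proof.
move=> hre him; have r0 : (0 <= r)%R by have := normr_ge0 (Re x); lra.
rewrite normcE -(ger0_norm (_ : 0 <= 12 * r)%R); last by rewrite mulr_ge0.
rewrite -sqrtr_sqr ler_wsqrtr//.
move: hre him; rewrite -(real_normK (num_real (Re x))) -(real_normK (num_real (Im x))).
by move: (normr_ge0 (Re x)) (normr_ge0 (Im x)) => *; nra.
Qed.

End ComplexParts.

Section DavydovComplex.
Context d (T : measurableType d) (R : realType).
Variable P : probability T R.
Implicit Types X Y : T -> R[i].

Local Notation Re := (@complex.Re R).
Local Notation Im := (@complex.Im R).

Lemma measurable_Re X : measurable_wrt measurable X -> measurable_fun setT (Re \o X).
Proof. by move=> mX _ B mB; rewrite setTI; have [] := mX B mB. Qed.

Lemma measurable_Im X : measurable_wrt measurable X -> measurable_fun setT (Im \o X).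
Proof. by move=> mX _ B mB; rewrite setTI; have [] := mX B mB. Qed.

Lemma measurable_normc X : measurable_wrt measurable X ->
  measurable_fun setT (fun w => Normc.normc (X w)).
Proof.
move=> mX; have [mR mI] := (measurable_Re mX, measurable_Im mX).
apply: (eq_measurable_fun (fun w => Num.sqrt ((Re \o X) w ^+ 2 + (Im \o X) w ^+ 2)%R)).
  by move=> w _; rewrite normcE.
apply: (@measurableT_comp _ _ _ _ _ _ (@Num.sqrt R)) => //.
  by apply: continuous_measurable_fun; exact: sqrt_continuous.
by apply: measurable_funD; exact: measurable_funX.
Qed.

Lemma dependence_le1 A B : measurable A -> measurable B ->
  (`|fine (P (A `&` B)) - fine (P A) * fine (P B)| <= 1)%R.
Proof.
have unit C : measurable C -> (0 <= fine (P C) <= 1)%R.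
  move=> mC; rewrite fine_ge0//= -lee_fin fineK ?probability_le1//.
  exact: fin_num_measure.
move=> mA mB; have /andP[a0 a1] := unit _ mA.
have /andP[b0 b1] := unit _ mB.
have /andP[c0 c1] := unit _ (measurableI _ _ mA mB).
by rewrite ler_norml; apply/andP; split; nra.
Qed.

Lemma alpha_mixing_ge (F G : set (set T)) A B :
  F `<=` measurable -> G `<=` measurable -> F A -> G B ->
  (`|fine (P (A `&` B)) - fine (P A) * fine (P B)| <= alpha_mixing P F G)%R.
Proof.
move=> mF mG FA GB; apply: ub_le_sup; last by exists A, B.
exists 1%R => _ [A' [B' [FA' GB' ->]]].
exact: dependence_le1 (mF _ FA') (mG _ GB').
Qed.

Lemma alpha_mixing_le1 (F G : set (set T)) : F !=set0 -> G !=set0 ->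
  F `<=` measurable -> G `<=` measurable -> (alpha_mixing P F G <= 1)%R.
Proof.
move=> [A FA] [B GB] mF mG; apply: ge_sup; first by eexists; exists A, B.
move=> _ [A' [B' [FA' GB' ->]]].
exact: dependence_le1 (mF _ FA') (mG _ GB').
Qed.

(** The real part of the covariance is Cov(Re, Re) - Cov(Im, Im), its imaginary
    part Cov(Re, Im) + Cov(Im, Re), and all four real covariances obey the real
    inequality since |Re z| and |Im z| are at most |z|. *)
Lemma complex_davydov (F G : set (set T)) (xi eta : T -> R[i]) (p q A B : R) :
    F `<=` measurable -> G `<=` measurable ->
    measurable_wrt F xi -> measurable_wrt G eta ->
    (0 < p)%R -> (0 < q)%R -> (p^-1 + q^-1 < 1)%R ->
    Lpnorm P 1 xi < +oo -> Lpnorm P 1 eta < +oo ->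
    Lpnorm P p xi <= A%:E -> Lpnorm P q eta <= B%:E ->
  (Normc.normc (ccovariance P xi eta) <=
   12 * (A * B * alpha_mixing P F G `^ (1 - p^-1 - q^-1)))%R.
Proof.
move=> mF mG xiF etaG p0 q0 pq xi1 eta1 xip etaq.
set alpha := alpha_mixing P F G.
have alpha0 : (0 <= alpha)%R.
  have [FA _] := xiF _ measurableT; have [GB _] := etaG _ measurableT.
  exact: le_trans (normr_ge0 _) (alpha_mixing_ge mF mG FA GB).
have mxi : measurable_wrt measurable xi.
  by move=> C mC; have [h1 h2] := xiF _ mC; split; exact: mF.
have meta : measurable_wrt measurable eta.
  by move=> C mC; have [h1 h2] := etaG _ mC; split; exact: mG.
have [xR xI] := (measurable_Re mxi, measurable_Im mxi).
have [yR yI] := (measurable_Re meta, measurable_Im meta).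
have bound (X : T -> R[i]) (f : R[i] -> R) (r C : R) :
    measurable_wrt measurable X -> measurable_fun setT (f \o X) ->
    (forall z, `|f z| <= Normc.normc z)%R -> (0 < r)%R ->
    Lpnorm P r X <= C%:E -> 'N[P]_r%:E[EFin \o (f \o X)] <= C%:E.
  move=> mX mfX fn r0; apply: le_trans; apply: le_Lnorm => //.
    exact: measurable_normc.
  by move=> w; rewrite /= [leRHS]ger0_norm ?normc_ge0.
have int (X : T -> R[i]) (f : R[i] -> R) :
    measurable_fun setT (f \o X) -> measurable_wrt measurable X ->
    (forall z, `|f z| <= Normc.normc z)%R ->
    Lpnorm P 1 X < +oo -> P.-integrable setT (EFin \o (f \o X)).
  move=> mfX mX fn X1.
  have iX : P.-integrable setT (EFin \o (fun w => Normc.normc (X w))).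
    apply/integrableP; split; first exact/measurable_EFinP/measurable_normc.
    by move: X1; rewrite /Lpnorm Lnorm1.
  apply: le_integrable iX => //; first exact/measurable_EFinP.
  by move=> w _; rewrite lee_fin /= [leRHS]ger0_norm ?normc_ge0.
have key (f g : R[i] -> R) : measurable_fun setT (f \o xi) ->
    measurable_fun setT (g \o eta) ->
    (forall C, measurable C -> F ((f \o xi) @^-1` C)) ->
    (forall C, measurable C -> G ((g \o eta) @^-1` C)) ->
    (forall z, `|f z| <= Normc.normc z)%R ->
    (forall z, `|g z| <= Normc.normc z)%R ->
    integrable_triple P (f \o xi) (g \o eta) /\
    (`|rcov P (f \o xi) (g \o eta)| <=
      4 * (A * B * alpha `^ (1 - p^-1 - q^-1)))%R.
  move=> mf mg fF gG fn gn; apply: real_davydov => //.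
  - by move=> C D mC mD; apply: alpha_mixing_ge => //; [exact: fF|exact: gG].
  - exact: int.
  - exact: int.
  - exact: bound.
  - exact: bound.
have FR C (mC : measurable C) : F ((Re \o xi) @^-1` C) by have [] := xiF _ mC.
have FI C (mC : measurable C) : F ((Im \o xi) @^-1` C) by have [] := xiF _ mC.
have GR C (mC : measurable C) : G ((Re \o eta) @^-1` C) by have [] := etaG _ mC.
have GI C (mC : measurable C) : G ((Im \o eta) @^-1` C) by have [] := etaG _ mC.
have [[_ _ iRR] cRR] := key _ _ xR yR FR GR (@Re_le_normc R) (@Re_le_normc R).
have [[_ _ iRI] cRI] := key _ _ xR yI FR GI (@Re_le_normc R) (@Im_le_normc R).
have [[_ _ iIR] cIR] := key _ _ xI yR FI GR (@Im_le_normc R) (@Re_le_normc R).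
have [[_ _ iII] cII] := key _ _ xI yI FI GI (@Im_le_normc R) (@Im_le_normc R).
have ReE : Re (ccovariance P xi eta) = (rcov P (Re \o xi) (Re \o eta) -
    rcov P (Im \o xi) (Im \o eta))%R.
  rewrite /ccovariance Re_subc Re_mulc /cexpectation/= unlock.
  have -> : fine (\int[P]_w (Re (xi w * eta w)%R)%:E) =
      (\int[P]_w ((Re \o xi) w * (Re \o eta) w) -
       \int[P]_w ((Im \o xi) w * (Im \o eta) w))%R.
    rewrite -RintegralB//; apply: eq_Rintegral => w _.
    by rewrite Re_mulc.
  by rewrite /rcov /Rintegral/=; ring.
have ImE : Im (ccovariance P xi eta) = (rcov P (Re \o xi) (Im \o eta) +
    rcov P (Im \o xi) (Re \o eta))%R.
  rewrite /ccovariance Im_subc Im_mulc /cexpectation/= unlock.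
  have -> : fine (\int[P]_w (Im (xi w * eta w)%R)%:E) =
      (\int[P]_w ((Re \o xi) w * (Im \o eta) w) +
       \int[P]_w ((Im \o xi) w * (Re \o eta) w))%R.
    rewrite -RintegralD//; apply: eq_Rintegral => w _.
    by rewrite Im_mulc.
  by rewrite /rcov /Rintegral/=; ring.
apply: normc_le_parts; rewrite ?ReE ?ImE.
- by apply: le_trans (ler_normB _ _) _; lra.
- by apply: le_trans (ler_normD _ _) _; lra.
Qed.

End DavydovComplex.

(** * Generating functions and Grand Lebesgue norms *)

Section GeneratingFunctions.
Context (R : realType).
Implicit Types (psi nu : R -> \bar R) (b : \bar R).

Lemma Psi_finite b psi p : Psi b psi -> (1 <= p)%R -> p%:E < b -> psi p < +oo.
Proof.
move=> [_ dom _ _] p1 pb; suff : [set q | psi q < +oo] p by [].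
by case: dom => [->//|[_ ->]]; split=> //; exact: ltW.
Qed.

Lemma Psi_finite_le b psi p : Psi b psi -> psi p < +oo -> (1 <= p)%R /\ p%:E <= b.
Proof.
move=> [_ dom _ _] pp; have : [set q | psi q < +oo] p by [].
by case: dom => [->|[_ ->]] [p1 pb]; split=> //; exact: ltW.
Qed.

Lemma Psi_finite1 b psi : Psi b psi -> psi 1%R < +oo.
Proof. by move=> h; have [b1 _ _ _] := h; exact: Psi_finite h _ _. Qed.

Lemma Psi_lower_bound b psi : Psi b psi ->
  exists2 c : R, (0 < c)%R & forall p, c%:E <= psi p.
Proof.
move=> h; have [_ _ _ inf0] := h.
have infle p : ereal_inf (range psi) <= psi p by apply: ereal_inf_lbound; exists p.
have inffin : ereal_inf (range psi) \is a fin_num.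
  rewrite gt0_fin_numE//; exact: le_lt_trans (infle _) (Psi_finite1 h).
exists (fine (ereal_inf (range psi))) => [|p]; last by rewrite fineK.
by rewrite fine_gt0// inf0 -ge0_fin_numE ?ltW.
Qed.

Lemma Psi_finiteP b psi p : Psi b psi -> psi p < +oo ->
  exists2 r : R, (0 < r)%R & psi p = r%:E.
Proof.
move=> h pp; have [c c0 cle] := Psi_lower_bound h.
have psi0 : 0 < psi p by apply: lt_le_trans (cle p); rewrite lte_fin.
exists (fine (psi p)); first by rewrite fine_gt0// psi0.
by rewrite fineK// gt0_fin_numE.
Qed.

Lemma Psi_gt0 b psi p : Psi b psi -> 0 < psi p.
Proof.
move=> h; have [c c0 cle] := Psi_lower_bound h.
by apply: lt_le_trans (cle p); rewrite lte_fin.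
Qed.

End GeneratingFunctions.

Section GrandLebesgue.
Context d (T : measurableType d) (R : realType).
Variable P : probability T R.
Implicit Types (psi : R -> \bar R) (b : \bar R) (X : T -> R[i]).

Lemma Lpnorm_le_GLS b psi X p r : Psi b psi -> psi p = r%:E ->
  Lpnorm P p X <= GLS_norm P psi X * r%:E.
Proof.
move=> h pr.
have r0 : (0 < r)%R by rewrite -lte_fin -pr; exact: Psi_gt0 h.
have pp : psi p < +oo by rewrite pr ltry.
rewrite -lee_pdivrMr//.
apply: ereal_sup_ubound; exists p => /=.
  by split => //; have [] := Psi_finite_le h pp.
by rewrite pr inver gt_eqF.
Qed.

Lemma GLS_norm_ge0 b psi X : Psi b psi -> 0 <= GLS_norm P psi X.
Proof.
move=> h; have [r r0 pr] := Psi_finiteP h (Psi_finite1 h).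
have := le_trans (Lnorm_ge0 _ _ _) (Lpnorm_le_GLS X h pr).
by rewrite pmule_lge0// lte_fin.
Qed.

Lemma GLS_normK b psi X : Psi b psi -> in_GLS P psi X ->
  GLS_norm P psi X = (fine (GLS_norm P psi X))%:E.
Proof.
by move=> h [_ X1]; rewrite fineK// ge0_fin_numE// (GLS_norm_ge0 X h).
Qed.

End GrandLebesgue.

(** * The two expressions of the fundamental function *)

Section RealLine.
Context (R : realType).

Lemma conj_exponent (p : R) : (1 < p)%R ->
  (1 <= p / (p - 1))%R /\ (p / (p - 1))^-1%R = (1 - p^-1)%R.
Proof.
move=> p1; have pB : (0 < p - 1)%R by lra.
split; first by rewrite ler_pdivlMr// mul1r; lra.
by field; apply/andP; split; rewrite gt_eqF//; lra.
Qed.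

Lemma closure_left (x y : R) : (x < y)%R -> closure [set q : R | (x <= q < y)%R] y.
Proof.
move=> xy B /nbhs_ballP[e /= e0 eB].
pose q := Num.max x (y - e / 2)%R.
have q_lt : (q < y)%R by rewrite gt_max xy/=; lra.
have q_ge : (y - e / 2 <= q)%R by rewrite le_max lexx orbT.
exists q; split => /=; first by rewrite le_max lexx.
by apply: eB; rewrite /ball/= ger0_norm; lra.
Qed.

Lemma closure_right (x : R) (b : \bar R) : x%:E < b ->
  closure [set q : R | (x < q)%R /\ q%:E < b] x.
Proof.
move=> xb B /nbhs_ballP[e /= e0 eB].
have [y xy yb] : exists2 y, (x < y)%R & y%:E <= b.
  case: b xb => [y| |//]; first by rewrite lte_fin => xy; exists y.
  by move=> _; exists (x + 1)%R; rewrite ?leey//; lra.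
pose q := ((x + Num.min y (x + e)) / 2)%R.
have q1 : (x < Num.min y (x + e))%R by rewrite lt_min xy/=; lra.
have q2 : (Num.min y (x + e) <= y)%R by rewrite ge_min lexx.
have q3 : (Num.min y (x + e) <= x + e)%R by rewrite ge_min lexx orbT.
exists q; split => /=.
  split; first by rewrite /q; lra.
  by apply: lt_le_trans yb; rewrite lte_fin /q; lra.
by apply: eB; rewrite /ball/= ltr0_norm /q; lra.
Qed.

End RealLine.

Section PhiTheta.
Context (R : realType).
Variables (b1 b2 : \bar R) (psi nu : R -> \bar R).
Hypotheses (hpsi : Psi b1 psi) (hnu : Psi b2 nu).
Variable a : R.
Hypothesis a01 : (0 < a <= 1)%R.

Let a0 : (0 < a)%R. Proof. by case/andP: a01. Qed.

Lemma powR_inv_le1 p : (0 < p)%R -> (0 < a `^ p^-1 <= 1)%R.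
Proof.
move=> p0; rewrite powR_gt0//= -(powRr0 a) ger_powR// invr_ge0; exact: ltW.
Qed.

Lemma Phi_term_fin p q r s : psi p = r%:E -> nu q = s%:E ->
  (a `^ p^-1 * a `^ q^-1)%:E / (psi p * nu q) =
  (a `^ p^-1 / r * (a `^ q^-1 / s))%R%:E.
Proof.
move=> pr qs.
have r0 : (0 < r)%R by rewrite -lte_fin -pr; exact: Psi_gt0 hpsi.
have s0 : (0 < s)%R by rewrite -lte_fin -qs; exact: Psi_gt0 hnu.
rewrite pr qs -EFinM inver gt_eqF ?mulr_gt0// -EFinM; congr EFin.
by rewrite invfM mulrACA.
Qed.

(** In the extended reals the inverse of +oo is 0: exponents outside the domain
    of psi or nu do not contribute to the supremum. *)
Lemma Phi_term_infty p q : ~ (psi p < +oo /\ nu q < +oo) ->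
  (a `^ p^-1 * a `^ q^-1)%:E / (psi p * nu q) = 0.
Proof.
move=> h; have -> : psi p * nu q = +oo.
  have [pp|] := boolP (psi p < +oo).
    have [qq|] := boolP (nu q < +oo); first by exfalso; exact: h.
    by rewrite -leNgt leye_eq => /eqP ->; rewrite gt0_muley// (Psi_gt0 _ hpsi).
  by rewrite -leNgt leye_eq => /eqP ->; rewrite gt0_mulye// (Psi_gt0 _ hnu).
by rewrite invey mule0.
Qed.

Lemma Phi_ge0 : 0 <= Phi psi nu a a.
Proof.
apply: (@le_trans _ _ ((a `^ (4 : R)^-1 * a `^ (4 : R)^-1)%:E / (psi 4 * nu 4))).
  apply: mule_ge0; first by rewrite lee_fin mulr_ge0 ?powR_ge0.
  by rewrite inve_ge0 mule_ge0// ltW// (Psi_gt0 _ hpsi, Psi_gt0 _ hnu).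
apply: ereal_sup_ubound; exists (4, 4)%R => //.
by split => /=; lra.
Qed.

Lemma Phi_lt_pinfty : Phi psi nu a a < +oo.
Proof.
have [c c0 cle] := Psi_lower_bound hpsi.
have [e e0 ele] := Psi_lower_bound hnu.
apply: (@le_lt_trans _ _ (c^-1 * e^-1)%R%:E); last exact: ltry.
apply: ge_ereal_sup => _ [[p q] [/= p1 q1 _] <-].
have [[pp qq]|/Phi_term_infty ->] := pselect (psi p < +oo /\ nu q < +oo); last first.
  by rewrite lee_fin mulr_ge0 ?invr_ge0// ltW.
have [r r0 pr] := Psi_finiteP hpsi pp.
have [s s0 qs] := Psi_finiteP hnu qq.
rewrite (Phi_term_fin pr qs) lee_fin.
have /andP[x0 x1] := powR_inv_le1 (lt_le_trans ltr01 p1).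
have /andP[y0 y1] := powR_inv_le1 (lt_le_trans ltr01 q1).
have cr : (r^-1 <= c^-1)%R by rewrite lef_pV2// -lee_fin -pr.
have es : (s^-1 <= e^-1)%R by rewrite lef_pV2// -lee_fin -qs.
have r1 : (0 <= r^-1)%R by rewrite invr_ge0 ltW.
have s1 : (0 <= s^-1)%R by rewrite invr_ge0 ltW.
apply: ler_pM; rewrite ?mulr_ge0 ?powR_ge0//.
- by apply: le_trans cr; rewrite ler_piMl.
- by apply: le_trans es; rewrite ler_piMl.
Qed.

(** The inequality a^(1/q) / nu(q) <= M is a closed condition on the domain
    of nu, where both sides are continuous; a bound on a set of exponents
    therefore extends to the end points that are in the domain. *)
Lemma le_nu_closure (U : set R) (q0 M : R) :
    U `<=` [set q | nu q < +oo] -> nu q0 < +oo -> closure U q0 ->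
    (forall q, U q -> (a `^ q^-1 <= M * fine (nu q))%R) ->
  (a `^ q0^-1 <= M * fine (nu q0))%R.
Proof.
move=> Udom q0dom clU UM.
have [_ _ cnu _] := hnu.
have [q01 _] := Psi_finite_le hnu q0dom.
have q00 : (0 < q0)%R := lt_le_trans ltr01 q01.
rewrite leNgt; apply/negP => lt0.
pose D := [set q | nu q < +oo].
have cvnu : fine (nu q) @[q --> within D (nbhs q0)] --> fine (nu q0).
  apply: fine_cvg; rewrite fineK; last by have [s _ ->] := Psi_finiteP hnu q0dom.
  by move/subspace_continuousP : cnu; exact.
have cva : (a `^ q^-1)%R @[q --> within D (nbhs q0)] --> (a `^ q0^-1)%R.
  apply: cvg_within_filter; rewrite /powR gt_eqF//.
  apply: (@continuous_cvg _ _ _ _ _ _ (@expR R)); first exact: continuous_expR.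
  by apply: cvgMr_tmp; apply: (@cvgV _ _ _ _ id) => //; rewrite gt_eqF.
have : (a `^ q^-1 - M * fine (nu q))%R @[q --> within D (nbhs q0)] -->
    (a `^ q0^-1 - M * fine (nu q0))%R.
  by apply: cvgB => //; exact: cvgMl_tmp.
move=> /cvgr_gt /(_ 0%R); rewrite subr_gt0 => /(_ lt0).
rewrite near_withinE => nearq.
have [q [Uq /=]] := clU _ nearq.
by move=> /(_ (Udom _ Uq)); rewrite subr_gt0 ltNge UM.
Qed.

Lemma phi_trunc_fin s : (1 <= s)%R -> s%:E < b2 ->
  exists2 t : R, (0 < t)%R & phi_trunc b2 nu s a = t%:E.
Proof.
move=> s1 sb; rewrite /phi_trunc sb.
set S := ereal_sup _.
have [e e0 ele] := Psi_lower_bound hnu.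
have Sle : S <= e^-1%:E.
  apply: ge_ereal_sup => _ [q [/= sq qb] <-].
  have [r r0 qr] := Psi_finiteP hnu (Psi_finite hnu (le_trans s1 sq) qb).
  rewrite qr inver gt_eqF// lee_fin.
  have /andP[y0 y1] := powR_inv_le1 (lt_le_trans ltr01 (le_trans s1 sq)).
  have er : (r^-1 <= e^-1)%R by rewrite lef_pV2// -lee_fin -qr.
  by apply: le_trans er; rewrite ler_piMl// invr_ge0 ltW.
have [r r0 sr] := Psi_finiteP hnu (Psi_finite hnu s1 sb).
have S0 : 0 < S.
  apply: (@lt_le_trans _ _ ((a `^ s^-1)%:E / nu s)).
    by rewrite sr inver gt_eqF// lte_fin divr_gt0// powR_gt0.
  by apply: ereal_sup_ubound; exists s.
have Sf : S \is a fin_num by rewrite gt0_fin_numE// (le_lt_trans Sle)// ltry.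
by exists (fine S); rewrite ?fineK// fine_gt0// S0 -gt0_fin_numE.
Qed.

Lemma fundamental_term_fin p r t : psi p = r%:E -> (0 < t)%R ->
  phi_trunc b2 nu (p / (p - 1))%R a = t%:E ->
  (a `^ p^-1)%:E / theta psi b2 nu a p = (a `^ p^-1 / r * t)%R%:E.
Proof.
move=> pr t0 pt.
have r0 : (0 < r)%R by rewrite -lte_fin -pr; exact: Psi_gt0 hpsi.
rewrite /theta pr pt inver gt_eqF// -EFinM inver gt_eqF ?divr_gt0// -EFinM.
by rewrite invfM invrK mulrA.
Qed.

(** The two reasons for which theta is +oo: psi is infinite at p, or the
    truncated supremum is over the empty set and vanishes. *)
Lemma fundamental_term_infty p : (1 < p)%R ->
  ~ (psi p < +oo /\ (p / (p - 1))%:E < b2) ->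
  (a `^ p^-1)%:E / theta psi b2 nu a p = 0.
Proof.
move=> p1 h; have [s1 _] := conj_exponent p1.
suff -> : theta psi b2 nu a p = +oo by rewrite invey mule0.
rewrite /theta; have [sb|sb] := boolP ((p / (p - 1))%:E < b2).
  have [pp|] := boolP (psi p < +oo); first by exfalso; exact: h.
  rewrite -leNgt leye_eq => /eqP ->.
  have [t t0 ->] := phi_trunc_fin s1 sb.
  by rewrite inver gt_eqF// gt0_mulye// lte_fin invr_gt0.
rewrite /phi_trunc (negbTE sb) inve0 gt0_muley//; exact: Psi_gt0 hpsi.
Qed.

Lemma fundamental_theta_ge0 : 0 <= fundamental_theta psi b2 nu a a.
Proof.
apply: (@le_trans _ _ ((a `^ (2 : R)^-1)%:E / theta psi b2 nu a 2)); last first.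
  by apply: ereal_sup_ubound; exists 2%R => //=; lra.
have p1 : (1 < 2 :> R)%R by lra.
have [[pp sb]|] := pselect (psi 2%R < +oo /\ (2 / (2 - 1) : R)%:E < b2); last first.
  by move/(fundamental_term_infty p1) => ->.
have [r r0 pr] := Psi_finiteP hpsi pp.
have [t t0 pt] := phi_trunc_fin (conj_exponent p1).1 sb.
rewrite (fundamental_term_fin pr t0 pt) lee_fin.
by rewrite mulr_ge0 ?divr_ge0 ?powR_ge0// ltW.
Qed.

(** An exponent q of the index set T satisfies p' < q <= b2, so that only
    q = b2 may be missing from the truncated supremum; it is a limit of
    exponents of [p', b2[. *)
Lemma Phi_le_fundamental : Phi psi nu a a <= fundamental_theta psi b2 nu a a.
Proof.
apply: ge_ereal_sup => _ [[p q] [/= p1 q1 pq] <-].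
have [[pp qq]|/Phi_term_infty ->] := pselect (psi p < +oo /\ nu q < +oo); last first.
  exact: fundamental_theta_ge0.
have [r r0 pr] := Psi_finiteP hpsi pp.
have [s s0 qs] := Psi_finiteP hnu qq.
have q0 : (0 < q)%R by apply: lt_le_trans q1.
have p0 : (0 < p)%R by apply: lt_le_trans p1.
have iq0 : (0 < q^-1)%R by rewrite invr_gt0.
have p1' : (1 < p)%R by rewrite -invf_lt1//; lra.
have [s1 sV] := conj_exponent p1'.
set p' := (p / (p - 1))%R in s1 sV *.
have p'0 : (0 < p')%R by apply: lt_le_trans s1.
have p'q : (p' < q)%R by rewrite -ltf_pV2// sV; lra.
have [_ qb] := Psi_finite_le hnu qq.
have p'b : p'%:E < b2 by apply: lt_le_trans qb; rewrite lte_fin.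
have [t t0 pt] := phi_trunc_fin s1 p'b.
rewrite (Phi_term_fin pr qs).
apply: (@le_trans _ _ ((a `^ p^-1)%:E / theta psi b2 nu a p)); last first.
  by apply: ereal_sup_ubound; exists p.
rewrite (fundamental_term_fin pr t0 pt) lee_fin ler_wpM2l//.
  by rewrite divr_ge0 ?powR_ge0// ltW.
have below u : (p' <= u)%R -> u%:E < b2 -> (a `^ u^-1 <= t * fine (nu u))%R.
  move=> p'u ub.
  have [v v0 uv] := Psi_finiteP hnu (Psi_finite hnu (le_trans s1 p'u) ub).
  rewrite uv -ler_pdivrMr// -lee_fin -pt /phi_trunc p'b.
  by apply: ereal_sup_ubound; exists u => //; rewrite uv inver gt_eqF.
rewrite ler_pdivrMr//; have -> : s = fine (nu q) by rewrite qs.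
move: qb; rewrite le_eqVlt => /orP[/eqP qb|qb]; last exact: below (ltW p'q) qb.
apply: (le_nu_closure (U := [set u | (p' <= u < q)%R])) => //.
- move=> u /= /andP[p'u uq]; apply: (Psi_finite hnu (le_trans s1 p'u)).
  by rewrite -qb lte_fin.
- exact: closure_left.
- by move=> u /= /andP[p'u uq]; apply: below => //; rewrite -qb lte_fin.
Qed.

(** Only q = p' occurs in the truncated supremum without (p, q) being in T;
    it is a limit from the right of exponents below b2. *)
Lemma fundamental_le_Phi : fundamental_theta psi b2 nu a a <= Phi psi nu a a.
Proof.
apply: ge_ereal_sup => _ [p /= p1 <-].
have [[pp sb]|/(fundamental_term_infty p1) ->] :=
  pselect (psi p < +oo /\ (p / (p - 1))%:E < b2); last exact: Phi_ge0.
have [r r0 pr] := Psi_finiteP hpsi pp.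
have [s1 sV] := conj_exponent p1.
have [t t0 pt] := phi_trunc_fin s1 sb.
rewrite (fundamental_term_fin pr t0 pt).
have PhiE : Phi psi nu a a = (fine (Phi psi nu a a))%:E.
  by rewrite fineK// ge0_fin_numE ?Phi_ge0// Phi_lt_pinfty.
set M := fine _ in PhiE; rewrite PhiE lee_fin.
have x0 : (0 < a `^ p^-1 / r)%R by rewrite divr_gt0// powR_gt0.
rewrite mulrC -ler_pdivlMr//; set N := (M / _)%R.
rewrite -lee_fin -pt /phi_trunc sb.
set p' := (p / (p - 1))%R in s1 sV sb pt *.
have p'0 : (0 < p')%R by apply: lt_le_trans s1.
have above u : (p' < u)%R -> u%:E < b2 -> (a `^ u^-1 <= N * fine (nu u))%R.
  move=> p'u ub.
  have u1 : (1 <= u)%R by rewrite (le_trans s1)// ltW.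
  have u0 : (0 < u)%R by apply: lt_le_trans u1.
  have [v v0 uv] := Psi_finiteP hnu (Psi_finite hnu u1 ub).
  rewrite uv -ler_pdivrMr// /N ler_pdivlMr// mulrC -lee_fin -PhiE.
  rewrite -(Phi_term_fin pr uv); apply: ereal_sup_ubound; exists (p, u) => //.
  split => //=; first exact: ltW.
  by move: p'u; rewrite -ltf_pV2// sV; lra.
apply: ge_ereal_sup => _ [q [/= p'q qb] <-].
have q1 : (1 <= q)%R := le_trans s1 p'q.
have qq := Psi_finite hnu q1 qb.
have [v v0 qv] := Psi_finiteP hnu qq.
rewrite qv inver gt_eqF// lee_fin ler_pdivrMr//.
have -> : v = fine (nu q) by rewrite qv.
move: p'q; rewrite le_eqVlt => /orP[/eqP p'q|p'q]; last exact: above.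
rewrite -p'q; apply: (le_nu_closure (U := [set u | (p' < u)%R /\ u%:E < b2])).
- move=> u [p'u ub]; apply: (Psi_finite hnu) => //.
  by rewrite (le_trans s1)// ltW.
- by rewrite p'q.
- exact: closure_right.
- by move=> u [p'u ub]; exact: above.
Qed.

Lemma Phi_eq_fundamental : Phi psi nu a a = fundamental_theta psi b2 nu a a.
Proof.
by apply/eqP; rewrite eq_le Phi_le_fundamental fundamental_le_Phi.
Qed.

End PhiTheta.

(** * The covariance bound in Grand Lebesgue spaces *)

Theorem theorem4p1 (d : measure_display) (Omega : measurableType d)
    (R : realType) (P : probability Omega R)
    (b1 b2 : \bar R) (psi nu : R -> \bar R)
    (hpsi : Psi b1 psi) (hnu : Psi b2 nu)
    (F G : set (set Omega))
    (hF : sub_sigma_field F) (hG : sub_sigma_field G)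
    (halpha : (0 < alpha_mixing P F G)%R)
    (xi eta : Omega -> R[i])
    (hxi : in_GLS P psi xi) (hxiF : measurable_wrt F xi)
    (heta : in_GLS P nu eta) (hetaG : measurable_wrt G eta) :
  let alpha := alpha_mixing P F G in
  let num := 12%:E * alpha%:E * GLS_norm P psi xi * GLS_norm P nu eta in
  (Normc.normc (ccovariance P xi eta))%:E
    <= quotient_or_pinfty num (Phi psi nu alpha alpha) /\
  quotient_or_pinfty num (Phi psi nu alpha alpha) =
    quotient_or_pinfty num (fundamental_theta psi b2 nu alpha alpha).
Proof.
move=> alpha num.
have [[F0 _ _] mF] := hF; have [[G0 _ _] mG] := hG.
have alpha01 : (0 < alpha <= 1)%R.
  by rewrite halpha/= alpha_mixing_le1//; exists set0.
split; last by rewrite (Phi_eq_fundamental hpsi hnu alpha01).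
have Phi0 := Phi_ge0 hpsi hnu alpha.
have Phi_oo := Phi_lt_pinfty hpsi hnu alpha01.
rewrite /quotient_or_pinfty; case: eqP => [_|/eqP PhiN0]; first exact: leey.
have xiE := GLS_normK hpsi hxi; have etaE := GLS_normK hnu heta.
set N1 := fine _ in xiE; set N2 := fine _ in etaE.
have N10 : (0 <= N1)%R by rewrite -lee_fin -xiE (GLS_norm_ge0 _ _ hpsi).
have N20 : (0 <= N2)%R by rewrite -lee_fin -etaE (GLS_norm_ge0 _ _ hnu).
have numE : num = (12 * alpha * N1 * N2)%R%:E by rewrite /num xiE etaE.
have L1 b f (X : Omega -> R[i]) : Psi b f -> in_GLS P f X -> Lpnorm P 1 X < +oo.
  move=> hf hX; have [r r0 fr] := Psi_finiteP hf (Psi_finite1 hf).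
  apply: le_lt_trans (Lpnorm_le_GLS P X hf fr) _.
  by rewrite (GLS_normK hf hX) ltry.
set c := Normc.normc _.
have c0 : (0 <= c)%R by exact: normc_ge0.
have term (pq : R * R) : T_exponents pq ->
    c%:E * ((alpha `^ pq.1^-1 * alpha `^ pq.2^-1)%:E / (psi pq.1 * nu pq.2)) <= num.
  case: pq => p q [/= p1 q1 pq].
  have [[pp qq]|/(Phi_term_infty hpsi hnu) ->] :=
    pselect (psi p < +oo /\ nu q < +oo); last first.
    by rewrite mule0 numE lee_fin !mulr_ge0// ltW.
  have [r r0 pr] := Psi_finiteP hpsi pp; have [s s0 qs] := Psi_finiteP hnu qq.
  have davydov : (c <= 12 * ((N1 * r) * (N2 * s) *
      alpha `^ (1 - p^-1 - q^-1)))%R.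
    apply: complex_davydov => //.
    - exact: lt_le_trans p1.
    - exact: lt_le_trans q1.
    - exact: L1 hpsi hxi.
    - exact: L1 hnu heta.
    - by rewrite EFinM -xiE; exact: (Lpnorm_le_GLS P xi hpsi pr).
    - by rewrite EFinM -etaE; exact: (Lpnorm_le_GLS P eta hnu qs).
  rewrite (Phi_term_fin hpsi hnu _ pr qs) numE -EFinM lee_fin.
  set z := (_ * (_ / s))%R.
  have z0 : (0 <= z)%R by rewrite mulr_ge0 ?divr_ge0 ?powR_ge0// ltW.
  apply: (le_trans (ler_wpM2r z0 davydov)).
  have split_alpha : (alpha `^ (1 - p^-1 - q^-1) * alpha `^ p^-1 * alpha `^ q^-1
      = alpha)%R.
    have aN0 : alpha != 0%R by rewrite gt_eqF.
    rewrite -!powRD ?aN0 ?implybT// -[RHS]powRr1 ?(ltW halpha)//.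
    by congr (_ `^ _)%R; ring.
  rewrite le_eqVlt; apply/orP; left; apply/eqP.
  rewrite -[in RHS]split_alpha /z; field.
  by rewrite !gt_eqF.
have [->|cN0] := eqVneq c 0%R.
  by rewrite numE mule_ge0 ?inve_ge0// lee_fin !mulr_ge0// ltW.
have c_gt0 : (0 < c)%R by rewrite lt_neqAle eq_sym cN0.
have : Phi psi nu alpha alpha <= c^-1%:E * num.
  apply: ge_ereal_sup => _ [pq Tpq <-].
  by rewrite lee_pdivlMl//; exact: term.
have PhiE : Phi psi nu alpha alpha = (fine (Phi psi nu alpha alpha))%:E.
  by rewrite fineK// ge0_fin_numE.
have phi_gt0 : (0 < fine (Phi psi nu alpha alpha))%R.
  by rewrite fine_gt0// lt0e PhiN0 Phi0.
rewrite PhiE inver gt_eqF// lee_pdivlMr//.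
by rewrite lee_pdivlMl// -!EFinM.
Qed.
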